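(* Let $A\in\mathbb{R}^{m\times n}$, let $k\ge 1$ be an integer and let $q$ be an integer with $2k\le q\le n$. Let $x^*\in\mathbb{R}^n$ be a $k$-sparse vector and let $y:=Ax^*+\eta$ be its measurements, with measurement error $\eta\in\mathbb{R}^m$. Suppose the restricted isometry constant of $A$ satisfies one of the following conditions: (i) $\delta_{3k}<\alpha^*$, where $\alpha^*$ is the unique real root in $(0,1)$ of $$\left(\left\lceil \tfrac{q}{k}\right\rceil+1\right)^2\alpha^3+\left(\left\lceil \tfrac{q}{k}\right\rceil+1\right)^2\alpha^2+\frac{2}{3+\sqrt5}\,\alpha-\frac{2}{3+\sqrt5}=0;$$ (ii) $\displaystyle \delta_{3k}<\frac{2}{\sqrt{\phi^2+6\phi+1}+\phi+1}$, where $\displaystyle \phi=\frac{\sqrt5+1}{2}\left(\left\lceil \tfrac{q}{k}\right\rceil+1\right)$. Then the sequence $\{x^p\}_{p\ge 0}$ generated by the PGOT algorithm satisfies, for all $p\ge 0$, $$\|x^{p+1}-x^*\|_2\le \rho^p\|x^0-x^*\|_2+\frac{\tau}{1-\rho}\|\eta\|_2,$$ where $$\rho:=\frac{\sqrt5+1}{2}\left(\left\lceil \tfrac{q}{k}\right\rceil+1\right)\delta_{3k}\sqrt{\frac{1+\delta_k}{1-\delta_{2k}}}<1,\qquad \tau:=\frac{(\sqrt5+1)\left(\left\lceil \frac{q}{k}\right\rceil+1\right)(1+\delta_{2k})+4}{2\sqrt{1-\delta_{2k}}}.$$ In particular, if the measurements are accurate, i.e. $y=Ax^*$, then the sequence $\{x^p\}$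 generated by PGOT converges to $x^*$.
   Context: $\|x\|_0$ is the number of nonzero entries of $x$; $x$ is $s$-sparse if $\|x\|_0\le s$. $\lceil\cdot\rceil$ is the ceiling function, $\mathbf{e}\in\mathbb{R}^n$ is the vector of ones, and $\otimes$ is the entrywise (Hadamard) product of vectors. Restricted isometry constant: for an integer $s>0$, $\delta_s$ is the smallest number $\delta_s\ge 0$ such that $(1-\delta_s)\|x\|_2^2\le\|Ax\|_2^2\le(1+\delta_s)\|x\|_2^2$ for all $s$-sparse $x\in\mathbb{R}^n$. Hard thresholding: $\mathcal{H}_q(z)$ retains the $q$ entries of $z$ of largest magnitude and sets all other entries to zero (ties broken arbitrarily). PGOT algorithm (partial gradient optimal $k$-thresholding), with inputs $A,y,k,q$: start from $x^0=0$ and for $p=0,1,2,\dots$ set $u^p=x^p+\mathcal{H}_q\left(A^T(y-Ax^p)\right)$; $w^p\in\arg\min_w\{\|y-A(w\otimes u^p)\|_2^2:\ \mathbf{e}^Tw=k,\ w\in\{0,1\}^n\}$ (any minimizer); $x^{p+1}=w^p\otimes u^p$. *)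

(* Defs.v *)
From mathcomp Require Import all_boot all_order all_algebra.
From mathcomp Require Import all_classical all_reals all_analysis.

Set Implicit Arguments.
Unset Strict Implicit.
Unset Printing Implicit Defensive.

Import Order.TTheory GRing.Theory Num.Theory.
Import numFieldNormedType.Exports.

Local Open Scope ring_scope.
Local Open Scope classical_set_scope.

(* The canonical norm `|x| on matrices is the sup norm, hence this one. *)
Definition norm2 (R : realType) (n : nat) (x : 'cV[R]_n) : R :=
  Num.sqrt (\sum_i x i 0 ^+ 2).

Definition norm0 (R : realType) (n : nat) (x : 'cV[R]_n) : nat :=
  #|[set i | x i 0 != 0]%SET|.

Definition sparse (R : realType) (n s : nat) (x : 'cV[R]_n) : Prop :=
  (norm0 x <= s)%N.

Definition hadamard (R : realType) (n : nat) (w u : 'cV[R]_n) : 'cV[R]_n :=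
  map2_mx *%R w u.

Definition restricted_isometry (R : realType) (m n : nat) (A : 'M[R]_(m, n))
    (s : nat) (d : R) : Prop :=
  0 <= d /\
  forall x : 'cV[R]_n, sparse s x ->
    (1 - d) * norm2 x ^+ 2 <= norm2 (A *m x) ^+ 2 /\
    norm2 (A *m x) ^+ 2 <= (1 + d) * norm2 x ^+ 2.

(* The infimum is always attained: see ric_least. *)
Definition ric (R : realType) (m n : nat) (A : 'M[R]_(m, n)) (s : nat) : R :=
  inf [set d | restricted_isometry A s d].

Lemma norm2_sqr (R : realType) (n : nat) (x : 'cV[R]_n) :
  norm2 x ^+ 2 = \sum_i x i 0 ^+ 2.
Proof. by rewrite sqr_sqrtr// sumr_ge0// => i _; rewrite sqr_ge0. Qed.

Lemma norm2_mulmx_bound (R : realType) (m n : nat) (A : 'M[R]_(m, n))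
    (x : 'cV[R]_n) :
  norm2 (A *m x) ^+ 2 <= (\sum_i (\sum_j `|A i j|) ^+ 2) * norm2 x ^+ 2.
Proof.
rewrite norm2_sqr mulr_suml; apply: ler_sum => i _.
rewrite -exprMn -real_normK ?num_real//.
have x_ge0 : 0 <= norm2 x by exact: sqrtr_ge0.
rewrite lerXn2r ?nnegrE ?mulr_ge0 ?sumr_ge0// mxE.
apply: le_trans (ler_norm_sum _ _ _) _.
rewrite mulr_suml; apply: ler_sum => j _; rewrite normrM ler_wpM2l//.
rewrite -sqrtr_sqr ler_wsqrtr// (bigD1 j)//= lerDl.
by rewrite sumr_ge0// => l _; rewrite sqr_ge0.
Qed.

Lemma ric_least (R : realType) (m n : nat) (A : 'M[R]_(m, n)) (s : nat) :
  restricted_isometry A s (ric A s) /\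
  forall d, restricted_isometry A s d -> ric A s <= d.
Proof.
set E := [set d | restricted_isometry A s d].
have E_lb : has_lbound E by exists 0 => d [].
have E_n0 : E !=set0.
  set C := \sum_i (\sum_j `|A i j|) ^+ 2.
  have C_ge0 : 0 <= C by rewrite sumr_ge0// => i _; rewrite sqr_ge0.
  exists (1 + C); split; first by rewrite addr_ge0.
  move=> x _; split.
    rewrite opprD addrA subrr add0r mulNr (@le_trans _ _ 0) ?sqr_ge0//.
    by rewrite oppr_le0 mulr_ge0 ?sqr_ge0.
  apply: le_trans (norm2_mulmx_bound A x) _.
  by rewrite ler_wpM2r ?sqr_ge0// addrA lerDr.
have E_inf : has_inf E by [].
split; last by move=> d Ed; exact: ge_inf.
split; first by apply: lb_le_inf => // d [].
move=> x sx; set N := norm2 x ^+ 2.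
have N_ge0 : 0 <= N by rewrite sqr_ge0.
have close e : 0 < e -> exists2 d, E d & d < ric A s + e.
  by move=> e0; exact: inf_adherent.
have [N0|N_neq0] := eqVneq N 0.
  have [d [_ Ed]] := E_n0; have := Ed _ sx.
  by rewrite -/N N0 !mulr0.
have N_gt0 : 0 < N by rewrite lt0r N_neq0.
split; apply/ler_addgt0Pr => e e0.
  have [d [_ Ed] dlt] := close (e / N) (divr_gt0 e0 N_gt0).
  have [Ed1 _] := Ed _ sx.
  apply: le_trans (_ : (1 - d) * N + e <= _); last by rewrite lerD2r.
  have -> : e = e / N * N by rewrite divfK.
  rewrite -mulrDl ler_wpM2r// -addrA lerD2l.
  by rewrite addrC -opprB lerN2 lerBlDr ltW.
have [d [_ Ed] dlt] := close (e / N) (divr_gt0 e0 N_gt0).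
have [_ Ed2] := Ed _ sx.
apply: le_trans Ed2 _; rewrite -/N.
have -> : e = e / N * N by rewrite divfK.
by rewrite -mulrDl ler_wpM2r// -addrA lerD2l ltW.
Qed.

(* A relation rather than a function: the index set S of retained entries is
   not unique when there are ties. *)
Definition hard_threshold (R : realType) (n q : nat) (z h : 'cV[R]_n) : Prop :=
  exists S : {set 'I_n},
    [/\ #|S| = q,
        forall i j, i \in S -> j \notin S -> `|z j 0| <= `|z i 0|
      & h = \col_i (if i \in S then z i 0 else 0)].

Definition binary_k (R : realType) (n k : nat) (w : 'cV[R]_n) : Prop :=
  ((const_mx 1 : 'cV[R]_n)^T *m w) 0 0 = k%:R /\
  forall i, w i 0 = 0 \/ w i 0 = 1.

Definition optimal_k_selection (R : realType) (m n : nat) (A : 'M[R]_(m, n))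
    (y : 'cV[R]_m) (k : nat) (u w : 'cV[R]_n) : Prop :=
  binary_k k w /\
  forall w' : 'cV[R]_n, binary_k k w' ->
    norm2 (y - A *m hadamard w u) ^+ 2 <= norm2 (y - A *m hadamard w' u) ^+ 2.

Definition PGOT_step (R : realType) (m n : nat) (A : 'M[R]_(m, n))
    (y : 'cV[R]_m) (k q : nat) (x x' : 'cV[R]_n) : Prop :=
  exists h u w : 'cV[R]_n,
    [/\ hard_threshold q (A^T *m (y - A *m x)) h,
        u = x + h,
        optimal_k_selection A y k u w
      & x' = hadamard w u].

Definition PGOT (R : realType) (m n : nat) (A : 'M[R]_(m, n))
    (y : 'cV[R]_m) (k q : nat) (x : nat -> 'cV[R]_n) : Prop :=
  x 0%N = 0 /\ forall p, PGOT_step A y k q (x p) (x p.+1).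

Definition ceil_ratio (R : realType) (q k : nat) : R :=
  (Num.ceil (q%:R / k%:R : R))%:~R.

Definition alpha_root (R : realType) (q k : nat) (a : R) : Prop :=
  (0 < a < 1) /\
  (ceil_ratio R q k + 1) ^+ 2 * a ^+ 3 + (ceil_ratio R q k + 1) ^+ 2 * a ^+ 2
    + 2 / (3 + Num.sqrt 5) * a - 2 / (3 + Num.sqrt 5) = 0.

Definition phi (R : realType) (q k : nat) : R :=
  (Num.sqrt 5 + 1) / 2 * (ceil_ratio R q k + 1).

Definition rho (R : realType) (m n : nat) (A : 'M[R]_(m, n)) (k q : nat) : R :=
  (Num.sqrt 5 + 1) / 2 * (ceil_ratio R q k + 1) * ric A (3 * k)
    * Num.sqrt ((1 + ric A k) / (1 - ric A (2 * k))).

Definition tau (R : realType) (m n : nat) (A : 'M[R]_(m, n)) (k q : nat) : R :=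
  ((Num.sqrt 5 + 1) * (ceil_ratio R q k + 1) * (1 + ric A (2 * k)) + 4)
    / (2 * Num.sqrt (1 - ric A (2 * k))).

(* Main.v *)
(* Let v = x* - x, r = A^T (y - A x) and e = r - v, let S be the index set
   retained by the thresholding and T a k-element set containing supp x*.
   Since w minimizes the residual, it does at least as well as the indicator of
   T, so with the isometry bounds of order k and 2k the new error is controlled
   by the norm of (v - H_q r) on T.  Because |S| = q >= 2k >= |supp v|, that
   norm is at most the golden ratio times the norm of e on T union S.  Cutting
   T union S into ceil(q/k) + 1 blocks of size at most k, on each of which e has
   norm at most delta_3k |v| + sqrt(1 + delta_k) |eta|, gives a contraction of
   factor rho; rho < 1 follows from either hypothesis on delta_3k after bounding
   delta_k and delta_2k by delta_3k. *)

Require Import Defs.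
From mathcomp Require Import all_boot all_order all_algebra.
From mathcomp Require Import all_classical all_reals all_analysis.
From mathcomp Require Import zify ring lra.

Set Implicit Arguments.
Unset Strict Implicit.
Unset Printing Implicit Defensive.

Import Order.TTheory GRing.Theory Num.Theory.
Import numFieldNormedType.Exports.

Local Open Scope ring_scope.
Local Open Scope classical_set_scope.

(** * Inner products, Euclidean norms and restriction to index sets *)

Definition dot (R : realType) (n : nat) (u v : 'cV[R]_n) : R :=
  \sum_i u i 0 * v i 0.

Definition restr (R : realType) (n : nat) (U : {set 'I_n}) (z : 'cV[R]_n) :
    'cV[R]_n :=
  \col_i (if i \in U then z i 0 else 0).

Lemma norm2_ge0 (R : realType) (n : nat) (x : 'cV[R]_n) : 0 <= norm2 x.
Proof. exact: sqrtr_ge0. Qed.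

Lemma norm2_comb (R : realType) (n : nat) (s t : R) (u v : 'cV[R]_n) :
  norm2 (s *: u + t *: v) ^+ 2 =
  s ^+ 2 * norm2 u ^+ 2 + 2 * s * t * dot u v + t ^+ 2 * norm2 v ^+ 2.
Proof.
rewrite !norm2_sqr /dot !mulr_sumr -!big_split/=.
by apply: eq_bigr => i _; rewrite !mxE; ring.
Qed.

Lemma dotDr (R : realType) (n : nat) (u v w : 'cV[R]_n) :
  dot u (v + w) = dot u v + dot u w.
Proof.
by rewrite /dot -big_split/=; apply: eq_bigr => i _; rewrite mxE mulrDr.
Qed.

Lemma dotNr (R : realType) (n : nat) (u v : 'cV[R]_n) :
  dot u (- v) = - dot u v.
Proof. by rewrite /dot -sumrN; apply: eq_bigr => i _; rewrite mxE mulrN. Qed.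

Lemma dot_trmx (R : realType) (m n : nat) (A : 'M[R]_(m, n)) (u : 'cV[R]_n)
    (v : 'cV[R]_m) :
  dot u (A^T *m v) = dot (A *m u) v.
Proof.
rewrite /dot; under eq_bigr do rewrite mxE mulr_sumr.
rewrite exchange_big/=; apply: eq_bigr => j _.
by rewrite mxE mulr_suml; apply: eq_bigr => i _; rewrite mxE; ring.
Qed.

(* Inserting s = c, t = a gives 2ac b <= 2d(ac)^2. *)
Lemma quadratic_form_bound (R : realType) (a b c d : R) :
  0 <= a -> 0 <= c -> 0 <= d ->
  (forall s t : R, 2 * s * t * b <= d * (s ^+ 2 * a ^+ 2 + t ^+ 2 * c ^+ 2)) ->
  b <= d * (a * c).
Proof.
move=> a0 c0 d0 H.
have [ac0|ac0] := eqVneq (a * c) 0.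
  rewrite ac0 mulr0.
  move/eqP: ac0; rewrite mulf_eq0 => /orP[]/eqP E.
    (* With a = 0, this choice of s and t gives (d c^2 + 2) b^2 <= 0, hence b = 0; the case c = 0 is
       symmetric. *)
    have := H (d * c ^+ 2 + 1) b; rewrite E.
    have : 0 <= d * c ^+ 2 by rewrite mulr_ge0// sqr_ge0.
    nra.
  have := H b (d * a ^+ 2 + 1); rewrite E.
  have : 0 <= d * a ^+ 2 by rewrite mulr_ge0// sqr_ge0.
  nra.
have acp : 0 < a * c by rewrite lt0r ac0 mulr_ge0.
have := H c a => H'.
rewrite -(ler_pM2l acp); lra.
Qed.

(** Cauchy-Schwarz is the case d = 1 of [quadratic_form_bound], whose hypothesis is then |s u - t
    v|^2 >= 0. *)
Lemma dot_le_norm2 (R : realType) (n : nat) (u v : 'cV[R]_n) :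
  dot u v <= norm2 u * norm2 v.
Proof.
rewrite -[leRHS]mul1r; apply: quadratic_form_bound; rewrite ?norm2_ge0// => s t.
have := sqr_ge0 (norm2 (s *: u + (- t) *: v)); rewrite norm2_comb; lra.
Qed.

Lemma ler_norm2D (R : realType) (n : nat) (u v : 'cV[R]_n) :
  norm2 (u + v) <= norm2 u + norm2 v.
Proof.
have u0 := norm2_ge0 u; have v0 := norm2_ge0 v.
rewrite -(@ler_pXn2r _ 2)// ?nnegrE ?norm2_ge0 ?addr_ge0//.
have := norm2_comb 1 1 u v; rewrite !scale1r => ->.
have := dot_le_norm2 u v; lra.
Qed.

Lemma norm2N (R : realType) (n : nat) (u : 'cV[R]_n) : norm2 (- u) = norm2 u.
Proof.
by rewrite /norm2; congr Num.sqrt; apply: eq_bigr => i _; rewrite mxE sqrrN.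
Qed.

Lemma norm2_restr (R : realType) (n : nat) (U : {set 'I_n}) (z : 'cV[R]_n) :
  norm2 (restr U z) ^+ 2 = \sum_(i in U) z i 0 ^+ 2.
Proof.
rewrite norm2_sqr [RHS]big_mkcond; apply: eq_bigr => i _; rewrite mxE.
by case: ifP => // _; rewrite expr0n.
Qed.

Lemma dot_restr (R : realType) (n : nat) (U : {set 'I_n}) (z : 'cV[R]_n) :
  dot (restr U z) z = norm2 (restr U z) ^+ 2.
Proof.
rewrite norm2_restr [RHS]big_mkcond; apply: eq_bigr => i _; rewrite mxE.
by case: ifP => // _; rewrite mul0r.
Qed.

Lemma supp_sparse (R : realType) (n s : nat) (U : {set 'I_n}) (z : 'cV[R]_n) :
  (#|U| <= s)%N -> (forall i, i \notin U -> z i 0 = 0) -> sparse s z.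
Proof.
move=> Us zU; apply: leq_trans Us; apply: subset_leq_card.
apply/fintype.subsetP => i; rewrite inE; apply: contraR => /zU ->; exact: eqxx.
Qed.

Lemma restr_sparse (R : realType) (n s : nat) (U : {set 'I_n}) (z : 'cV[R]_n) :
  (#|U| <= s)%N -> sparse s (restr U z).
Proof.
by move=> Us; apply: supp_sparse Us _ => i /negbTE iU; rewrite mxE iU.
Qed.

(** * Index sets of prescribed size, blocks and counting *)

Lemma exists_subset_card (T : finType) (U : {set T}) (k : nat) :
  (k <= #|U|)%N -> exists2 B : {set T}, B \subset U & #|B| = k.
Proof.
move=> kU; exists [set x in take k (enum U)]%SET.
  by apply/fintype.subsetP => x; rewrite inE => /mem_take; rewrite mem_enum.
rewrite cardsE; have/card_uniqP -> : uniq (take k (enum U)).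
  by rewrite take_uniq// enum_uniq.
by rewrite size_takel// -cardE.
Qed.

(** Serves to enlarge the support of x* to exactly k indices, because [binary_k] asks for exactly k
    ones. *)
Lemma exists_superset_card (n k : nat) (U : {set 'I_n}) :
  (#|U| <= k)%N -> (k <= n)%N ->
  exists2 B : {set 'I_n}, U \subset B & #|B| = k.
Proof.
move=> Uk kn.
have [|B BU Bc] := @exists_subset_card _ (~: U)%SET (n - k).
  by rewrite cardsCs finset.setCK card_ord leq_sub2l.
exists (~: B)%SET; first by rewrite -finset.subsetC.
by rewrite cardsCs finset.setCK card_ord Bc subKn.
Qed.

(** Squared norms add over disjoint index sets, so peeling off k indices at a time costs at most M^2
    per block. *)
Lemma norm2_restr_blocks (R : realType) (n k : nat) (e : 'cV[R]_n) (M : R) :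
  (forall B : {set 'I_n}, (#|B| <= k)%N -> norm2 (restr B e) ^+ 2 <= M ^+ 2) ->
  forall (N : nat) (U : {set 'I_n}), (#|U| <= N * k)%N ->
    norm2 (restr U e) ^+ 2 <= N%:R * M ^+ 2.
Proof.
move=> HM; elim=> [|N IH] U UN.
  move: UN; rewrite mul0n leqn0 cards_eq0 => /eqP ->.
  by rewrite norm2_restr big_set0 mul0r.
have M0 : 0 <= N%:R * M ^+ 2 by rewrite mulr_ge0// sqr_ge0.
have [Uk|/ltnW kU] := leqP #|U| k.
  by apply: le_trans (HM _ Uk) _; rewrite -natr1 mulrDl mul1r lerDr.
have [B BU Bk] := exists_subset_card kU.
rewrite norm2_restr (big_setID B)/= -!norm2_restr (finset.setIidPr BU).
rewrite -natr1 mulrDl mul1r addrC lerD ?HM ?Bk// IH//.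
by rewrite cardsD (finset.setIidPr BU) Bk leq_subLR -mulSn.
Qed.

(** The minimum of [f] over [Y] separates the two sums: it bounds each term over [X] from above and
    each term over [Y] from below. *)
Lemma ler_sum_card (R : realType) (T : finType) (X Y : {set T}) (f : T -> R) :
  (#|X| <= #|Y|)%N -> (forall i, 0 <= f i) ->
  (forall i j, i \in X -> j \in Y -> f i <= f j) ->
  \sum_(i in X) f i <= \sum_(i in Y) f i.
Proof.
move=> XY f0 fXY.
have [Y0|/set0Pn[y0 y0Y]] := eqVneq Y finset.set0.
  move: XY; rewrite Y0 cards0 leqn0 cards_eq0 => /eqP ->.
  by rewrite !big_set0.
have [y yY ymin] := arg_minP f y0Y.
apply: (@le_trans _ _ (f y *+ #|X|)).
  by rewrite -sumr_const; apply: ler_sum => i iX; exact: fXY.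
apply: (@le_trans _ _ (f y *+ #|Y|)); first by rewrite ler_wpMn2l.
by rewrite -sumr_const; apply: ler_sum => i iY; exact: ymin.
Qed.

(** * Consequences of the restricted isometry property *)

Lemma restricted_isometry_le (R : realType) (m n : nat) (A : 'M[R]_(m, n))
    (s s' : nat) (d : R) :
  (s <= s')%N -> restricted_isometry A s' d -> restricted_isometry A s d.
Proof.
by move=> ss' [d0 H]; split=> // x sx; apply: H; exact: leq_trans ss'.
Qed.

Lemma ric_le (R : realType) (m n : nat) (A : 'M[R]_(m, n)) (s s' : nat) :
  (s <= s')%N -> ric A s <= ric A s'.
Proof.
move=> ss'; apply: (ric_least A s).2; apply: restricted_isometry_le ss' _.
exact: (ric_least A s').1.
Qed.

Lemma ric_ge0 (R : realType) (m n : nat) (A : 'M[R]_(m, n)) (s : nat) :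
  0 <= ric A s.
Proof. by have [[]] := ric_least A s. Qed.

Lemma ric_norm2_le (R : realType) (m n : nat) (A : 'M[R]_(m, n)) (s : nat)
    (x : 'cV[R]_n) :
  sparse s x -> norm2 (A *m x) <= Num.sqrt (1 + ric A s) * norm2 x.
Proof.
move=> sx; have [[d0 H] _] := ric_least A s; have [_ Hx] := H x sx.
rewrite -(@ler_pXn2r _ 2)// ?nnegrE ?mulr_ge0 ?norm2_ge0 ?sqrtr_ge0//.
by rewrite exprMn [Num.sqrt (1 + _) ^+ 2]sqr_sqrtr// addr_ge0.
Qed.

Lemma ric_norm2_ge (R : realType) (m n : nat) (A : 'M[R]_(m, n)) (s : nat)
    (x : 'cV[R]_n) :
  ric A s <= 1 -> sparse s x ->
  Num.sqrt (1 - ric A s) * norm2 x <= norm2 (A *m x).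
Proof.
move=> d1 sx; have [[d0 H] _] := ric_least A s; have [Hx _] := H x sx.
rewrite -(@ler_pXn2r _ 2)// ?nnegrE ?mulr_ge0 ?norm2_ge0 ?sqrtr_ge0//.
by rewrite exprMn [Num.sqrt (1 - _) ^+ 2]sqr_sqrtr// subr_ge0.
Qed.

(* Polarization: compare the two isometry bounds at s u + t v and s u - t v. *)
Lemma ric_dot (R : realType) (m n : nat) (A : 'M[R]_(m, n)) (s : nat)
    (U : {set 'I_n}) (u v : 'cV[R]_n) :
  (#|U| <= s)%N ->
  (forall i, i \notin U -> u i 0 = 0) -> (forall i, i \notin U -> v i 0 = 0) ->
  dot (A *m u) (A *m v) - dot u v <= ric A s * (norm2 u * norm2 v).
Proof.
move=> Us uU vU; have [[d0 H] _] := ric_least A s.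
apply: quadratic_form_bound; rewrite ?norm2_ge0// => a b.
have sp c : sparse s (a *: u + c *: v).
  by apply: supp_sparse Us _ => i iU; rewrite !mxE uU// vU// !mulr0 addr0.
have [_] := H _ (sp b); have [+ _] := H _ (sp (- b)).
rewrite !mulmxDr -!scalemxAr !norm2_comb; lra.
Qed.

(** * Golden-ratio bound for the hard-thresholding error *)

Lemma golden_sqr (R : realType) :
  ((Num.sqrt 5 + 1) / 2 : R) ^+ 2 = (Num.sqrt 5 + 1) / 2 + 1.
Proof.
have : (Num.sqrt 5 : R) ^+ 2 = 5 by rewrite sqr_sqrtr.
by move=> H; rewrite expr_div_n sqrrD H; lra.
Qed.

(* The entries of r on (T :&: W) :\: S are dominated by those on S :\: W,
   where r and r - v agree; the matrix [[2, 1], [1, 1]], whose top eigenvalue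
   is the squared golden ratio, accounts for the two uses of S :\: W. *)
Lemma hard_threshold_error (R : realType) (n : nat) (v r : 'cV[R]_n)
    (S T W : {set 'I_n}) :
  (#|W| <= #|S|)%N -> (forall i, i \notin W -> v i 0 = 0) ->
  (forall i j, i \in S -> j \notin S -> `|r j 0| <= `|r i 0|) ->
  norm2 (restr T (v - restr S r))
    <= (Num.sqrt 5 + 1) / 2 * norm2 (restr (T :|: S) (r - v)).
Proof.
move=> WS vW rS; set e := r - v; set g := (_ / 2).
set E := restr (T :|: S) e.
pose X := ((T :&: W) :\: S)%SET.
pose a := norm2 (restr (T :&: S) e); pose b := norm2 (restr (T :\: S) e).
pose c := norm2 (restr (S :\: W) e); pose x := norm2 (restr X e).
have g2 : g ^+ 2 = g + 1 by exact: golden_sqr.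
have g0 : 0 <= g by rewrite divr_ge0// addr_ge0// sqrtr_ge0.
have sub_norm2 (Y Z : {set 'I_n}) (z : 'cV[R]_n) :
    Y \subset Z -> norm2 (restr Y z) ^+ 2 <= norm2 (restr Z z) ^+ 2.
  move=> YZ; rewrite !norm2_restr [leRHS](big_setID Y)/= (finset.setIidPr YZ).
  by rewrite lerDl sumr_ge0// => i _; exact: sqr_ge0.
have abE : a ^+ 2 + b ^+ 2 <= norm2 E ^+ 2.
  rewrite !norm2_restr -big_setID/= -!norm2_restr.
  exact/sub_norm2/finset.subsetUl.
have bcE : b ^+ 2 + c ^+ 2 <= norm2 E ^+ 2.
  rewrite /E !norm2_restr [leRHS](big_setID S)/= [leRHS]addrC.
  rewrite finset.setDUl finset.setDv finset.setU0 lerD2l.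
  rewrite (finset.setIidPr (finset.subsetUr _ _)) -!norm2_restr.
  exact/sub_norm2/finset.subsetDl.
have b0 : 0 <= b by exact: norm2_ge0.
have c0 : 0 <= c by exact: norm2_ge0.
have rX : norm2 (restr X r) <= c.
  rewrite -(@ler_pXn2r _ 2)// ?nnegrE ?norm2_ge0// !norm2_restr.
  have -> : \sum_(i in (S :\: W)%SET) e i 0 ^+ 2
      = \sum_(i in (S :\: W)%SET) r i 0 ^+ 2.
    by apply: eq_bigr => i; rewrite inE => /andP[iW _]; rewrite !mxE vW// subr0.
  apply: ler_sum_card => [|i|i j].
  (* [X] lies in [W :\: S], which is no larger than [S :\: W] because #|W| <= #|S|. *)
  - have XW : (#|X| <= #|W :\: S|)%N.
      by rewrite subset_leq_card// finset.setSD// finset.subsetIr.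
    have := cardsID S W; have := cardsID W S; rewrite finset.setIC; lia.
  - exact: sqr_ge0.
  - rewrite !inE => /and3P[iS _ _] /andP[_ jS].
    rewrite -[leLHS]real_normK ?num_real// -[leRHS]real_normK ?num_real//.
    by rewrite lerXn2r ?nnegrE// rS.
have vTS : norm2 (restr (T :\: S) v) <= c + b.
  (* On [X] one has v = r - e, and v vanishes outside [W]. *)
  have -> : restr (T :\: S) v = restr X r + - restr X e.
    apply/colP => i; rewrite !mxE !inE.
    case: (i \in S) => //=; rewrite ?subr0//.
    case: (i \in T) => //=; rewrite ?subr0//.
    have [_|/vW ->] := boolP (i \in W); last by rewrite subr0.
    by ring.
  apply: le_trans (ler_norm2D _ _) _; rewrite norm2N lerD//.
  rewrite -(@ler_pXn2r _ 2)// ?nnegrE ?norm2_ge0//.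
  apply: sub_norm2; apply: finset.setSD; exact: finset.subsetIl.
rewrite -(@ler_pXn2r _ 2)// ?nnegrE ?mulr_ge0 ?norm2_ge0//.
(* On [T :&: S] the vector is -e, on [T :\: S] it is v. *)
have -> : norm2 (restr T (v - restr S r)) ^+ 2
    = a ^+ 2 + norm2 (restr (T :\: S) v) ^+ 2.
  rewrite !norm2_restr (big_setID S)/=; congr (_ + _); apply: eq_bigr => i.
    by rewrite inE => /andP[_ iS]; rewrite !mxE iS; ring.
  by rewrite inE => /andP[/negbTE iS _]; rewrite !mxE iS subr0.
have v0 := norm2_ge0 (restr (T :\: S) v).
have vTS2 : norm2 (restr (T :\: S) v) ^+ 2 <= (c + b) ^+ 2.
  by rewrite lerXn2r ?nnegrE ?addr_ge0.
(* (g - 1) g = 1, so that (g - 1) c^2 + g b^2 - 2 b c = (g - 1) (c - g b)^2. *)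
have bc : 2 * b * c <= (g - 1) * c ^+ 2 + g * b ^+ 2.
  have g1 : 0 <= g - 1 by nra.
  have := mulr_ge0 g1 (sqr_ge0 (c - g * b)).
  have -> : (g - 1) * (c - g * b) ^+ 2 = (g - 1) * c ^+ 2
      - 2 * (g ^+ 2 - g) * c * b + (g ^+ 2 - g) * g * b ^+ 2 by ring.
  rewrite g2; lra.
(* a^2 + (c + b)^2 <= (a^2 + b^2) + g (b^2 + c^2) <= (1 + g) |E|^2, and 1 + g = g^2. *)
rewrite exprMn g2; have := ler_wpM2l g0 bcE; lra.
Qed.

(** * Error of a single PGOT iteration *)

(** Let z be the restricted vector. Then |z|^2 = (<Az, Av> - <z, v>) + <Az, eta>. The bracket is
    controlled at order 3k, since [B :|: W] has at most 3k indices, and the last term at order k;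
    dividing by |z| concludes. *)
Lemma residual_restr_bound (R : realType) (m n k : nat) (A : 'M[R]_(m, n))
    (W B : {set 'I_n}) (v : 'cV[R]_n) (eta : 'cV[R]_m) :
  (#|W| <= 2 * k)%N -> (#|B| <= k)%N -> (forall i, i \notin W -> v i 0 = 0) ->
  norm2 (restr B (A^T *m (A *m v + eta) - v))
    <= ric A (3 * k) * norm2 v + Num.sqrt (1 + ric A k) * norm2 eta.
Proof.
move=> Wk Bk vW; set e := (_ - v); set M := (_ + _).
have M0 : 0 <= M.
  by rewrite addr_ge0 ?mulr_ge0 ?norm2_ge0 ?ric_ge0 ?sqrtr_ge0.
set z := restr B e.
have [->//|N0] := eqVneq (norm2 z) 0.
have Np : 0 < norm2 z by rewrite lt0r N0 norm2_ge0.
rewrite -(ler_pM2l Np) -expr2 -(dot_restr B e) -/z /e.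
rewrite dotDr dotNr dot_trmx dotDr.
have UBW : (#|B :|: W| <= 3 * k)%N.
  by rewrite (leq_trans (leq_card_setU _ _))// mulSn leq_add.
have : dot (A *m z) (A *m v) - dot z v
    <= ric A (3 * k) * (norm2 z * norm2 v).
  apply: (ric_dot _ UBW) => i; rewrite inE negb_or => /andP[iB iW].
    by rewrite mxE (negbTE iB).
  exact: vW.
have := dot_le_norm2 (A *m z) eta.
have := ric_norm2_le A (restr_sparse e Bk); rewrite -/z.
move=> /(ler_wpM2r (norm2_ge0 eta)); rewrite /M; lra.
Qed.

Lemma norm2_distC (R : realType) (n : nat) (x y : 'cV[R]_n) :
  norm2 (x - y) = norm2 (y - x).
Proof. by rewrite -norm2N opprB. Qed.

(** Turns the ceiling into a number N of blocks of size k that suffices to cover q indices. *)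
Lemma ceil_ratioE (R : realType) (q k : nat) :
  (1 <= k)%N -> exists2 N : nat, ceil_ratio R q k = N%:R & (q <= N * k)%N.
Proof.
move=> k1; have k0 : 0 < (k%:R : R) by rewrite ltr0n.
have := ceil_ge (q%:R / k%:R : R).
have : 0 <= Num.ceil (q%:R / k%:R : R).
  by rewrite ceil_ge0 (lt_le_trans (ltrN10 R))// divr_ge0.
rewrite /ceil_ratio; case: (Num.ceil _) => // N _.
by rewrite ler_pdivrMr// -natrM ler_nat => qN; exists N.
Qed.

Lemma binary_k_card (R : realType) (n k : nat) (w : 'cV[R]_n) :
  binary_k k w -> #|[set i | w i 0 != 0]%SET| = k.
Proof.
move=> [wk w01]; apply/eqP; rewrite -(eqr_nat R) -wk mxE -sumr_const.
rewrite big_mkcond; apply/eqP; apply: eq_bigr => i _; rewrite !mxE inE mul1r.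
by case: (w01 i) => ->; rewrite ?eqxx// oner_eq0.
Qed.

Lemma binary_k_indicator (R : realType) (n k : nat) (T : {set 'I_n}) :
  #|T| = k -> binary_k k (\col_i (i \in T)%:R : 'cV[R]_n).
Proof.
move=> Tk; split=> [|i]; last by rewrite mxE; case: (i \in T); [right|left].
rewrite mxE -Tk -sumr_const [RHS]big_mkcond; apply: eq_bigr => i _.
by rewrite !mxE mul1r; case: (i \in T).
Qed.

Lemma hadamard_sparse (R : realType) (n k : nat) (w u : 'cV[R]_n) :
  binary_k k w -> sparse k (hadamard w u).
Proof.
move=> /binary_k_card wk; apply: (supp_sparse (eq_leq wk)) => i.
by rewrite inE negbK mxE => /eqP ->; rewrite mul0r.
Qed.

Lemma hadamard_indicator (R : realType) (n : nat) (T : {set 'I_n})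
    (u : 'cV[R]_n) : hadamard (\col_i (i \in T)%:R) u = restr T u.
Proof.
by apply/colP => i; rewrite !mxE; case: (i \in T); rewrite ?mul1r ?mul0r.
Qed.

(** The indicator of [T] is an admissible competitor, and xs - restr T u = restr T (xs - u) since xs
    vanishes off [T]. Removing the noise from either residual costs |eta|, whence the factor 2. *)
Lemma optimal_k_selection_error (R : realType) (m n k : nat)
    (A : 'M[R]_(m, n)) (xs u w : 'cV[R]_n) (eta : 'cV[R]_m) (T : {set 'I_n}) :
  #|T| = k -> (forall i, i \notin T -> xs i 0 = 0) ->
  optimal_k_selection A (A *m xs + eta) k u w ->
  norm2 (A *m (xs - hadamard w u))
    <= Num.sqrt (1 + ric A k) * norm2 (restr T (xs - u)) + 2 * norm2 eta.
Proof.
move=> Tk xsT [wk wmin].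
have := wmin _ (binary_k_indicator R Tk).
rewrite ler_pXn2r ?nnegrE ?norm2_ge0// hadamard_indicator.
rewrite !(addrAC _ eta) -!mulmxBr.
have -> : xs - restr T u = restr T (xs - u).
  apply/colP => i; rewrite !mxE; case: ifPn => [//|/xsT ->].
  by rewrite subr0.
set z := _ - _; set y := restr _ _ => zy.
have := ler_norm2D (A *m z + eta) (- eta); rewrite addrK norm2N.
have := ler_norm2D (A *m y) eta.
have := ric_norm2_le A (restr_sparse (xs - u) (eq_leq Tk)); rewrite -/y.
move: zy; lra.
Qed.

(** Sparsity of the new iterate is part of the conclusion so that the step can be iterated: it keeps
    the support of xs - x within 2k indices. *)
Lemma PGOT_step_error (R : realType) (m n k q : nat) (A : 'M[R]_(m, n))
    (xs x x' : 'cV[R]_n) (eta : 'cV[R]_m) :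
  (1 <= k)%N -> (2 * k <= q)%N -> (k <= n)%N -> ric A (2 * k) < 1 ->
  sparse k xs -> sparse k x -> PGOT_step A (A *m xs + eta) k q x x' ->
  sparse k x' /\
  norm2 (x' - xs) <= rho A k q * norm2 (x - xs) + tau A k q * norm2 eta.
Proof.
move=> k1 kq kn d1 sxs sx [h [u [w [[S [Sq Smax hS]] uE wopt x'E]]]].
have sx' : sparse k x' by rewrite x'E; apply: hadamard_sparse wopt.1.
split=> //.
have [T suppT Tk] := exists_superset_card sxs kn.
have xsT i : i \notin T -> xs i 0 = 0.
  apply: contraNeq => xsi; apply: (fintype.subsetP suppT).
  by rewrite inE.
pose v := xs - x.
pose W := ([set i | xs i 0 != 0] :|: [set i | x i 0 != 0])%SET.
have Wk : (#|W| <= 2 * k)%N.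
  by rewrite (leq_trans (leq_card_setU _ _))// mul2n -addnn leq_add.
have vW i : i \notin W -> v i 0 = 0.
  rewrite !inE negb_or !negbK !mxE => /andP[/eqP -> /eqP ->].
  by rewrite subr0.
have resE : A *m xs + eta - A *m x = A *m v + eta.
  by rewrite addrAC -mulmxBr.
rewrite {}resE in hS Smax.
pose r := A^T *m (A *m v + eta).
have [N NE qN] := ceil_ratioE R q k1.
pose M := ric A (3 * k) * norm2 v + Num.sqrt (1 + ric A k) * norm2 eta.
have M0 : 0 <= M.
  by rewrite addr_ge0 ?mulr_ge0 ?norm2_ge0 ?ric_ge0 ?sqrtr_ge0.
have blocks : norm2 (restr (T :|: S) (r - v)) <= (N%:R + 1) * M.
  have NS : (#|T :|: S| <= N.+1 * k)%N.
    by rewrite (leq_trans (leq_card_setU _ _))// Tk Sq mulSn leq_add2l.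
  rewrite -(@ler_pXn2r _ 2)// ?nnegrE ?norm2_ge0 ?(mulr_ge0 _ M0)//.
  have H := @norm2_restr_blocks _ _ k (r - v) M _ N.+1 _ NS.
  apply: le_trans (H _) _ => [B Bk|].
    rewrite lerXn2r ?nnegrE ?norm2_ge0//.
    exact: residual_restr_bound Wk Bk vW.
  (* The blocks give the factor sqrt(N + 1); it is relaxed to N + 1, the factor in [rho]. *)
  rewrite exprMn ler_wpM2r ?sqr_ge0// natr1 expr2 ler_peMl//.
  by rewrite ler1n.
(* The assumption 2k <= q makes [S] at least as large as the support of v. *)
have WS : (#|W| <= #|S|)%N by rewrite Sq (leq_trans Wk).
have := hard_threshold_error T WS vW Smax.
have -> : restr S (A^T *m (A *m v + eta)) = h by rewrite hS.
have -> : v - h = xs - u by rewrite uE opprD addrA.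
have := optimal_k_selection_error Tk xsT wopt; rewrite -x'E.
have sdiff : sparse (2 * k) (xs - x').
  pose W' := ([set i | xs i 0 != 0] :|: [set i | x' i 0 != 0])%SET.
  apply: (@supp_sparse _ _ _ W').
    by rewrite (leq_trans (leq_card_setU _ _))// mul2n -addnn leq_add.
  move=> i; rewrite !inE negb_or !negbK !mxE => /andP[/eqP -> /eqP ->].
  by rewrite subr0.
have := ric_norm2_ge (ltW d1) sdiff.
rewrite (norm2_distC x') (norm2_distC x) -/v.
have s2 : 0 < Num.sqrt (1 - ric A (2 * k)) by rewrite sqrtr_gt0 subr_gt0.
have dk0 := ric_ge0 A k.
rewrite /rho /tau NE sqrtrM ?addr_ge0// sqrtrV ?subr_ge0 ?(ltW d1)//.
have s1E : Num.sqrt (1 + ric A k) ^+ 2 = 1 + ric A k.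
  by rewrite sqr_sqrtr// addr_ge0.
have d12 : ric A k <= ric A (2 * k) by rewrite ric_le// leq_pmull.
have s10 := sqrtr_ge0 (1 + ric A k).
move: blocks; rewrite /M -/r.
have g0 : 0 <= (Num.sqrt 5 + 1) / 2 :> R.
  by rewrite divr_ge0// addr_ge0// sqrtr_ge0.
have N0 : 0 <= N%:R :> R by [].
have H0 := norm2_ge0 eta.
have -> : (Num.sqrt 5 + 1) * (N%:R + 1) * (1 + ric A (2 * k)) + 4
  = 2 * ((Num.sqrt 5 + 1) / 2 * (N%:R + 1) * (1 + ric A (2 * k)) + 2) :> R.
  lra.
move: s2 s1E s10 g0 N0 H0 d12 dk0.
set g := ((_ + 1) / 2 : R).
move: (Num.sqrt (1 - ric A (2 * k))) (Num.sqrt (1 + ric A k)) => s2 s1.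
move: g (N%:R : R) (norm2 eta)
  (norm2 v) (norm2 (xs - x')) (norm2 (A *m _)) (norm2 (restr T _))
  (norm2 (restr _ _)) (ric A (3 * k)) (ric A (2 * k)) (ric A k).
move=> g C H D L AL G E d3 d2 dk s20 s1E s10 g0 C0 H0 d12 dk0 EM L1 L2 GE.
rewrite -(ler_pM2l s20).
have -> : s2 * (g * (C + 1) * d3 * (s1 / s2) * D
      + 2 * (g * (C + 1) * (1 + d2) + 2) / (2 * s2) * H)
    = s1 * (g * ((C + 1) * (d3 * D))) + (g * (C + 1) * (1 + d2) + 2) * H.
  by field; rewrite gt_eqF.
(* The chain is s2 L <= AL <= s1 G + 2 H <= s1 g E + 2 H, followed by the block bound on E. *)
apply: le_trans L1 _; apply: le_trans L2 _.
have := ler_wpM2l s10 GE; have := ler_wpM2l s10 (ler_wpM2l g0 EM).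
(* The noise coefficient s1^2 = 1 + dk is relaxed to 1 + d2, as in [tau]. *)
have : s1 ^+ 2 * (g * (C + 1) * H) <= (1 + d2) * (g * (C + 1) * H).
  by rewrite ler_wpM2r ?mulr_ge0 ?addr_ge0// s1E lerD2l.
lra.
Qed.

(** * The cubic equation and the two sufficient conditions for rho < 1 *)

(** Strictness comes from the linear term; the higher powers are weakly increasing on nonnegative
    arguments. *)
Lemma alpha_cubic_lt (R : realType) (C K a b : R) :
  0 < K -> 0 <= a -> a < b ->
  C ^+ 2 * a ^+ 3 + C ^+ 2 * a ^+ 2 + K * a - K
    < C ^+ 2 * b ^+ 3 + C ^+ 2 * b ^+ 2 + K * b - K.
Proof.
move=> K0 a0 ab; have b0 : 0 <= b by rewrite (le_trans a0)// ltW.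
have lin : K * a < K * b by rewrite ltr_pM2l.
have pow i : C ^+ 2 * a ^+ i <= C ^+ 2 * b ^+ i.
  by rewrite ler_wpM2l ?sqr_ge0// lerXn2r ?nnegrE// ltW.
by have := pow 2; have := pow 3; lra.
Qed.

Lemma alpha_root_exists_unique (R : realType) (q k : nat) :
  (1 <= k)%N -> exists! alpha : R, alpha_root q k alpha.
Proof.
move=> k1; rewrite /alpha_root; have [N -> _] := ceil_ratioE R q k1.
set C : R := N%:R + 1.
have C0 : 0 < C by rewrite ltr_wpDl.
set K : R := 2 / (3 + Num.sqrt 5).
have K0 : 0 < K by rewrite divr_gt0// ltr_pwDl// sqrtr_ge0.
pose p : {poly R} :=
  (C ^+ 2) *: 'X^3 + (C ^+ 2) *: 'X^2 + K *: 'X - K%:P.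
have pE a : p.[a] = C ^+ 2 * a ^+ 3 + C ^+ 2 * a ^+ 2 + K * a - K.
  by rewrite /p !hornerE.
(* The polynomial equals -K < 0 at 0 and 2 C^2 > 0 at 1. *)
have [||a /andP[a0 a1] /rootP pa] := @poly_ivt _ p 0 1; first exact: ler01.
  rewrite !pE; have := sqr_ge0 C; lra.
rewrite pE in pa.
have lt0a : 0 < a.
  rewrite lt_neqAle a0 andbT; apply/eqP => a_0; move: pa; rewrite -a_0.
  lra.
have lta1 : a < 1.
  rewrite lt_neqAle a1 andbT; apply/eqP => a_1; move: pa; rewrite a_1.
  have := exprn_gt0 2 C0; lra.
exists a; split=> [|b [/andP[b0 b1] pb]]; first by rewrite lt0a lta1.
have [ab|ba|//] := ltgtP a b.
  by have := alpha_cubic_lt C K0 a0 ab; rewrite pa pb ltxx.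
by have := alpha_cubic_lt C K0 (ltW b0) ba; rewrite pa pb ltxx.
Qed.

Lemma rho_ge0 (R : realType) (m n : nat) (A : 'M[R]_(m, n)) (k q : nat) :
  (1 <= k)%N -> 0 <= rho A k q.
Proof.
move=> k1; have [N NE _] := ceil_ratioE R q k1.
by rewrite /rho NE !mulr_ge0 ?ric_ge0 ?sqrtr_ge0 ?addr_ge0 ?invr_ge0 ?sqrtr_ge0.
Qed.

Lemma tau_ge0 (R : realType) (m n : nat) (A : 'M[R]_(m, n)) (k q : nat) :
  (1 <= k)%N -> 0 <= tau A k q.
Proof.
move=> k1; have [N NE _] := ceil_ratioE R q k1.
by rewrite /tau NE divr_ge0 ?addr_ge0 ?mulr_ge0 ?sqrtr_ge0 ?ric_ge0
  ?addr_ge0 ?ric_ge0 ?sqrtr_ge0.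
Qed.

(** Replacing delta_k and delta_2k by d = delta_3k gives rho^2 <= (phi d)^2 (1 + d) / (1 - d). The
    hypothesis says that this quotient is below 1, and both conditions of the theorem are reduced to
    it. *)
Lemma rho_lt1 (R : realType) (m n : nat) (A : 'M[R]_(m, n)) (k q : nat) :
  (1 <= k)%N -> ric A (3 * k) < 1 ->
  (phi R q k * ric A (3 * k)) ^+ 2 * (1 + ric A (3 * k)) < 1 - ric A (3 * k) ->
  rho A k q < 1.
Proof.
move=> k1; set d := ric A (3 * k) => d1 H.
have dk : ric A k <= d by rewrite ric_le// leq_pmull.
have d2k : ric A (2 * k) <= d by rewrite ric_le// leq_mul.
have d0 : 0 <= d by exact: ric_ge0.
have dk0 := ric_ge0 A k.
have s2 : 0 < 1 - ric A (2 * k) by rewrite subr_gt0 (le_lt_trans d2k).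
rewrite -(@ltr_pXn2r _ 2)// ?nnegrE ?rho_ge0// expr1n.
rewrite /rho -/(phi R q k) -/d exprMn sqr_sqrtr; last first.
  by rewrite divr_ge0 ?(ltW s2)// addr_ge0.
rewrite mulrA ltr_pdivrMr// mul1r.
apply: (@le_lt_trans _ _ ((phi R q k * d) ^+ 2 * (1 + d))).
  by rewrite ler_wpM2l ?sqr_ge0// lerD2l.
by apply: lt_le_trans H _; rewrite lerD2l lerN2.
Qed.

(** With g the golden ratio, 2 / (3 + sqrt 5) = 1 / g^2. Multiplied by g^2, the cubic becomes (phi
    d)^2 (1 + d) + d - 1, which is negative below the root. *)
Lemma alpha_condition (R : realType) (q k : nat) (alpha d : R) :
  alpha_root q k alpha -> 0 <= d -> d < alpha ->
  d < 1 /\ (phi R q k * d) ^+ 2 * (1 + d) < 1 - d.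
Proof.
move=> [/andP[_ a1] pa] d0 da; split; first exact: lt_trans a1.
have s5 : (Num.sqrt 5 : R) ^+ 2 = 5 by rewrite sqr_sqrtr.
have s50 : 0 <= Num.sqrt 5 :> R by exact: sqrtr_ge0.
have S0 : 0 < 3 + Num.sqrt 5 :> R by rewrite ltr_pwDl.
have K0 : 0 < 2 / (3 + Num.sqrt 5) :> R by rewrite divr_gt0.
have := alpha_cubic_lt (ceil_ratio R q k + 1) K0 d0 da; rewrite pa.
rewrite /phi; set C := ceil_ratio R q k + 1; set K := (2 / _).
set g := (_ / 2); have gK : g ^+ 2 * K = 1.
  by rewrite /g /K expr_div_n sqrrD s5 expr1n mulr1; field; rewrite gt_eqF.
have g2 : 0 < g ^+ 2 by rewrite exprn_gt0// divr_gt0// ltr_wpDl.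
rewrite -(ltr_pM2l g2) mulr0.
have -> : g ^+ 2 * (C ^+ 2 * d ^+ 3 + C ^+ 2 * d ^+ 2 + K * d - K)
    = (g * C * d) ^+ 2 * (1 + d) + (g ^+ 2 * K) * (d - 1) by ring.
rewrite gK; lra.
Qed.

(* 2 / (Q + f + 1), with Q^2 = f^2 + 6 f + 1, is the positive root of
   f d^2 + (f + 1) d = 1. *)
Lemma phi_condition (R : realType) (f d : R) :
  0 <= f -> 0 <= d -> d < 2 / (Num.sqrt (f ^+ 2 + 6 * f + 1) + f + 1) ->
  d < 1 /\ (f * d) ^+ 2 * (1 + d) < 1 - d.
Proof.
move=> f0 d0; set Q := Num.sqrt _.
have Q2 : Q ^+ 2 = f ^+ 2 + 6 * f + 1.
  by rewrite sqr_sqrtr// !addr_ge0 ?sqr_ge0 ?mulr_ge0.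
have Q0 : 0 <= Q by exact: sqrtr_ge0.
have Qf : f + 1 <= Q.
  by rewrite -(@ler_pXn2r _ 2)// ?nnegrE ?addr_ge0// Q2; lra.
have P0 : 0 < Q + f + 1 by lra.
rewrite ltr_pdivlMr// => dP.
have quad : f * d ^+ 2 + (f + 1) * d < 1.
  have t2 : 0 < 2 - d * (Q + f + 1) by rewrite subr_gt0.
  (* Conjugate factor: as Q^2 - (f + 1)^2 = 4 f, its product with the factor in [t2] is 4 (1 - (f +
     1) d - f d^2). *)
  have t3 : 0 < 2 + (Q - (f + 1)) * d by rewrite ltr_pwDl// mulr_ge0// subr_ge0.
  have := mulr_gt0 t2 t3.
  have -> : (2 - d * (Q + f + 1)) * (2 + (Q - (f + 1)) * d)
      = 4 - 4 * (f + 1) * d - (Q ^+ 2 - (f + 1) ^+ 2) * d ^+ 2 by ring.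
  rewrite Q2; lra.
have fd0 : 0 <= f * d by exact: mulr_ge0.
have fdd0 : 0 <= f * d * d by exact: mulr_ge0.
split; first lra.
have fd1 : f * d <= 1 by lra.
have fdd : 0 <= f * d * (1 + d) by rewrite mulr_ge0// addr_ge0.
(* (f d)^2 (1 + d) <= f d (1 + d) = f d^2 + f d < 1 - d by [quad]. *)
have := ler_wpM2r fdd fd1; lra.
Qed.

(** * Iteration of the error bound and convergence *)

(** Transfers Euclidean estimates to the sup norm, in which the convergence of the iterates is
    checked. *)
Lemma mx_norm_le_norm2 (R : realType) (n : nat) (x : 'cV[R]_n) :
  `|x| <= norm2 x.
Proof.
rewrite /Num.norm/= mx_normrE.
apply: (big_ind (fun t => t <= norm2 x)) => [|s t sx tx|[i j] _].
- exact: norm2_ge0.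
- by rewrite ge_max sx.
- rewrite (ord1 j) -sqrtr_sqr ler_wsqrtr// (bigD1 i)//= lerDl.
  by rewrite sumr_ge0// => l _; exact: sqr_ge0.
Qed.

Theorem theorem2 (R : realType) (m n : nat) (A : 'M[R]_(m, n)) (k q : nat)
    (hk : (1 <= k)%N) (hkq : (2 * k <= q)%N) (hqn : (q <= n)%N)
    (xstar : 'cV[R]_n) (hxstar : sparse k xstar)
    (eta y : 'cV[R]_m) (hy : y = A *m xstar + eta) :
  (exists! alpha : R, alpha_root q k alpha) /\
  forall alpha_star : R, alpha_root q k alpha_star ->
    ric A (3 * k) < alpha_star \/
    ric A (3 * k)
      < 2 / (Num.sqrt (phi R q k ^+ 2 + 6 * phi R q k + 1) + phi R q k + 1) ->
    rho A k q < 1 /\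
    forall x : nat -> 'cV[R]_n, PGOT A y k q x ->
      (forall p : nat,
         norm2 (x p.+1 - xstar)
           <= rho A k q ^+ p * norm2 (x 0%N - xstar)
              + tau A k q / (1 - rho A k q) * norm2 eta) /\
      (y = A *m xstar -> x @ \oo --> xstar).
Proof.
split; first exact: alpha_root_exists_unique.
move=> alpha alphaP cond.
have phi0 : 0 <= phi R q k.
  have [N NE _] := ceil_ratioE R q hk.
  by rewrite /phi NE mulr_ge0 ?divr_ge0 ?addr_ge0 ?sqrtr_ge0.
have [d1 dphi] : ric A (3 * k) < 1 /\
    (phi R q k * ric A (3 * k)) ^+ 2 * (1 + ric A (3 * k)) < 1 - ric A (3 * k).
  case: cond => d_lt; first exact: alpha_condition alphaP (ric_ge0 _ _) d_lt.
  exact: phi_condition phi0 (ric_ge0 _ _) d_lt.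
have r1 := rho_lt1 hk d1 dphi; split=> // x [x0 xS].
have r0 := rho_ge0 A q hk; have t0 := tau_ge0 A q hk.
have d2 : ric A (2 * k) < 1 by apply: le_lt_trans d1; rewrite ric_le// leq_mul.
have kn : (k <= n)%N.
  by apply: leq_trans hqn; apply: leq_trans hkq; rewrite leq_pmull.
have sx p : sparse k (x p).
  elim: p => [|p IH].
    rewrite x0; apply: (@supp_sparse _ _ _ finset.set0).
      by rewrite cards0.
    by move=> i _; rewrite mxE.
  by have := xS p; rewrite hy => /(PGOT_step_error hk hkq kn d2 hxstar IH)[].
(* The induction carries exponent p at index p. It closes because tau / (1 - rho) is the fixed point
   of t -> rho t + tau. *)
have err p : norm2 (x p - xstar) <= rho A k q ^+ p * norm2 (x 0%N - xstar)
    + tau A k q / (1 - rho A k q) * norm2 eta.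
  elim: p => [|p IH].
    rewrite expr0 mul1r lerDl.
    by rewrite mulr_ge0 ?norm2_ge0// divr_ge0// subr_ge0 ltW.
  have := xS p; rewrite hy => /(PGOT_step_error hk hkq kn d2 hxstar (sx p))[_].
  move=> /le_trans; apply.
  apply: le_trans (lerD (ler_wpM2l r0 IH) (lexx _)) _.
  rewrite exprS le_eqVlt; apply/orP; left; apply/eqP; field.
  by rewrite subr_eq0 gt_eqF.
split=> [p|yE].
  (* The stated bound has exponent p at index p + 1, so one factor rho <= 1 is dropped. *)
  apply: le_trans (err p.+1) _; rewrite lerD2r exprS ler_wpM2r ?norm2_ge0//.
  by rewrite ler_piMl ?exprn_ge0// ltW.
have eta0 : norm2 eta = 0.
  have -> : eta = 0 by apply: (addrI (A *m xstar)); rewrite addr0 -hy.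
  by rewrite /norm2 big1 ?sqrtr0// => i _; rewrite mxE expr0n.
have geo : rho A k q ^+ p * norm2 (x 0%N - xstar) @[p --> \oo] --> (0 : R).
  rewrite -[X in _ --> X](mul0r (norm2 (x 0%N - xstar))).
  by apply: cvgMl; apply: cvg_expr; rewrite ger0_norm.
apply/cvgrPdist_le => e e0.
move/cvgrPdist_le : geo => /(_ e e0); apply: filterS => p.
rewrite sub0r normrN => /(le_trans (ler_norm _)); apply: le_trans.
apply: le_trans (mx_norm_le_norm2 _) _; rewrite (norm2_distC xstar).
by have := err p; rewrite eta0 mulr0 addr0.
Qed.
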